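(* For any $\delta\in(0,\tfrac1{64}]$, the map $\tilde\sigma^\delta$ on the metric space $(X,d)$ (both defined in the context) is a convex bicombing which is neither reversible nor consistent.
   Context: General definitions. Let $(X,d)$ be a metric space. A (geodesic) bicombing on $X$ is a map $\sigma\colon D(X):=X\times X\times[0,1]\to X$ such that, writing $\sigma_{pq}(t):=\sigma(p,q,t)$, for all $p,q\in X$ one has $\sigma_{pq}(0)=p$, $\sigma_{pq}(1)=q$, and $d(\sigma_{pq}(t),\sigma_{pq}(s))=|t-s|\cdot d(p,q)$ for all $s,t\in[0,1]$. It is convex if for all $p,q,p',q'\in X$ the function $t\mapsto d(\sigma_{pq}(t),\sigma_{p'q'}(t))$ is convex on $[0,1]$; reversible if $\sigma_{pq}(t)=\sigma_{qp}(1-t)$ for all $p,q\in X$, $t\in[0,1]$; consistent if for all $p,q\in X$ we have $\sigma_{p'q'}([0,1])\subset\sigma_{pq}([0,1])$ whenever $p'=\sigma_{pq}(s)$ and $q'=\sigma_{pq}(t)$ with $0\le s\le t\le1$. The space. Equip $\mathbb{R}^2$ with the norm $\|(x,y)\|:=\max\{|x|,\tfrac{\sqrt2}{2}\|(x,y)\|_2\}$, where $\|\cdot\|_2$ is the Euclidean norm. Let $$X:=\{(x,y)\in\mathbb{R}^2: -3\le x\le3,\ 0\le y\le\tfrac1{32}\max\{0,1-x^2\}\}$$ with the metric $d$ induced by $\|\cdot\|$. Write $X=X_-\cup X_0\cup X_+$ with $X_-:=[-3,-1]\times\{0\}$, $X_+:=[1,3]\times\{0\}$, and $X_0:=\{(x,y)\in\mathbb{R}^2:-1<x<1,\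 0\le y\le\tfrac1{32}(1-x^2)\}$. The maps. For $0\le\delta\le\tfrac1{64}$ define $\sigma^\delta\colon D(X)\to X$ as follows. For $p=(p_x,p_y)$, $q=(q_x,q_y)\in X$ with $p_x\le q_x$ let $\sigma^\delta_{pq}(t):=(x_{pq}(t),y_{pq}(t))$ and $\sigma^\delta_{qp}(t):=\sigma^\delta_{pq}(1-t)$, where $x_{pq}(t):=p_x+t(q_x-p_x)$ and $$y_{pq}(t):=\begin{cases}\delta\max\{q_x-p_x-4,0\}\max\{0,1-x_{pq}(t)^2\}&\text{if }p\in X_-,\ q\in X_+,\\ \max\{0,\frac{q_y}{q_x+1}(x_{pq}(t)+1)\}&\text{if }p\in X_-,\ q\in X_0,\\ \max\{0,\frac{p_y}{p_x-1}(x_{pq}(t)-1)\}&\text{if }p\in X_0,\ q\in X_+,\\ p_y+t(q_y-p_y)&\text{if }p,q\in X_0,\\ 0&\text{otherwise.}\end{cases}$$ Define $\tilde\sigma^\delta\colon D(X)\to X$ by $\tilde\sigma^\delta_{pq}(t):=\sigma^\delta_{pq}(t)$, except that for $p\in X_+$ and $q\in X_-$ we let $\tilde\sigma^\delta_{pq}(t):=(p_x+t(q_x-p_x),0)$. *)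

(* Defs.v *)
From HB Require Import structures.
From mathcomp Require Import all_boot all_order all_algebra interval_inference.
From mathcomp Require Import ring lra.
From mathcomp Require Import all_classical all_reals topology convex.

Set Implicit Arguments.
Unset Strict Implicit.
Unset Printing Implicit Defensive.

Import Order.TTheory GRing.Theory Num.Theory.

Local Open Scope classical_set_scope.
Local Open Scope ring_scope.

Section Bicombing.
Context {R : realType} {T : metricType R}.

(* [convex_function] takes functions on all of R; outside [0, 1] the function
   is given the junk value [f 0], which [convex_function `[0, 1]] never sees. *)
Definition extend01 (f : {i01 R} -> R) (t : R) : R := f (insubd 0%:i01 t).

Implicit Types sigma : T -> T -> {i01 R} -> T.

Definition bicombing sigma : Prop :=
  forall p q : T,
    [/\ sigma p q 0%:i01 = p,
        sigma p q 1%:i01 = q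
      & forall s t : {i01 R},
          mdist (sigma p q t) (sigma p q s)
            = `|t%:num - s%:num| * mdist p q].

Definition convex_bicombing sigma : Prop :=
  bicombing sigma /\
  forall p q p' q' : T,
    @convex_function R R^o `[0, 1]
      (extend01 (fun t => mdist (sigma p q t) (sigma p' q' t))).

Definition reversible sigma : Prop :=
  forall (p q : T) (t : {i01 R}),
    sigma p q t = sigma q p (1 - t%:num)%:i01.

Definition consistent sigma : Prop :=
  forall (p q p' q' : T) (s t : {i01 R}),
    s%:num <= t%:num -> p' = sigma p q s -> q' = sigma p q t ->
    range (sigma p' q') `<=` range (sigma p q).

End Bicombing.

Section PlaneNorm.
Context {R : realType}.
Implicit Types u v : R * R.

Definition norm2 u : R := Num.sqrt (u.1 ^+ 2 + u.2 ^+ 2).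

Definition plane_norm u : R :=
  Num.max `|u.1| (Num.sqrt 2 / 2 * norm2 u).

Let sqrt2_gt0 : 0 < Num.sqrt 2 / 2 :> R.
Proof. by rewrite divr_gt0// sqrtr_gt0. Qed.

Lemma norm2D u v : norm2 (u + v) <= norm2 u + norm2 v.
Proof.
have sq w : 0 <= w.1 ^+ 2 + w.2 ^+ 2 :> R by rewrite addr_ge0 ?sqr_ge0.
have sumge0 : 0 <= norm2 u + norm2 v by rewrite addr_ge0 ?sqrtr_ge0.
rewrite -[leRHS]ger0_norm// -sqrtr_sqr ler_wsqrtr//=.
have n2 w : norm2 w ^+ 2 = w.1 ^+ 2 + w.2 ^+ 2 by rewrite sqr_sqrtr.
rewrite [leRHS]sqrrD !n2.
suff : u.1 * v.1 + u.2 * v.2 <= norm2 u * norm2 v by nra.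
rewrite -sqrtrM//; apply: le_trans (ler_norm _) _.
rewrite -sqrtr_sqr ler_wsqrtr//.
by have := sqr_ge0 (u.1 * v.2 - u.2 * v.1); nra.
Qed.

Lemma norm2N u : norm2 (- u) = norm2 u.
Proof. by rewrite /norm2 /= !sqrrN. Qed.

Lemma plane_norm0 : plane_norm 0 = 0.
Proof. by rewrite /plane_norm /norm2 /= normr0 expr0n addr0 sqrtr0 mulr0 maxxx. Qed.

Lemma plane_norm_eq0 u : plane_norm u = 0 -> u = 0.
Proof.
move=> u0.
have : Num.sqrt 2 / 2 * norm2 u <= 0 by rewrite -u0 le_max lexx orbT.
rewrite pmulr_rle0// => n0.
have : norm2 u == 0 by rewrite eq_le n0 sqrtr_ge0.
rewrite sqrtr_eq0 => s0.
case: u s0 {u0 n0} => a b /= s0.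
have a0 : a ^+ 2 == 0 by have := sqr_ge0 a; have := sqr_ge0 b; lra.
have b0 : b ^+ 2 == 0 by have := sqr_ge0 a; have := sqr_ge0 b; lra.
by move: a0 b0; rewrite !sqrf_eq0 => /eqP-> /eqP->.
Qed.

Lemma plane_normN u : plane_norm (- u) = plane_norm u.
Proof. by rewrite /plane_norm norm2N /= normrN. Qed.

Lemma plane_normD u v : plane_norm (u + v) <= plane_norm u + plane_norm v.
Proof.
rewrite /plane_norm ge_max; apply/andP; split.
  by apply: le_trans (ler_normD _ _) _; apply: lerD; rewrite le_max lexx.
apply: le_trans (_ : _ <= Num.sqrt 2 / 2 * (norm2 u + norm2 v)) _.
  by rewrite ler_pM2l// norm2D.
by rewrite mulrDr; apply: lerD; rewrite le_max lexx orbT.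
Qed.

End PlaneNorm.

Section Space.
Context {R : realType}.
Implicit Types p : R * R.

Definition in_X p : bool :=
  (-3 <= p.1 <= 3) && (0 <= p.2 <= 32^-1 * Num.max 0 (1 - p.1 ^+ 2)).

Definition in_Xminus p : bool := (-3 <= p.1 <= -1) && (p.2 == 0).

Definition in_Xplus p : bool := (1 <= p.1 <= 3) && (p.2 == 0).

Definition in_X0 p : bool :=
  (-1 < p.1 < 1) && (0 <= p.2 <= 32^-1 * (1 - p.1 ^+ 2)).

End Space.

Record spaceX (R : realType) := SpaceX { pt :> R * R; ptP : in_X pt }.

HB.instance Definition _ (R : realType) := [isSub for @pt R].
HB.instance Definition _ (R : realType) := [Choice of spaceX R by <:].

Section Metric.
Context {R : realType}.
Implicit Types p q r : spaceX R.

Definition distX p q : R := plane_norm (pt p - pt q).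

Lemma distXxx p : distX p p = 0.
Proof. by rewrite /distX subrr plane_norm0. Qed.

Lemma distX_positivity p q : distX p q = 0 -> p = q.
Proof. by move/plane_norm_eq0/eqP; rewrite subr_eq0 => /eqP/val_inj. Qed.

Lemma distX_sym p q : distX p q = distX q p.
Proof. by rewrite /distX -plane_normN opprB. Qed.

Lemma distX_triangle q p r : distX p r <= distX p q + distX q r.
Proof.
rewrite /distX (_ : pt p - pt r = (pt p - pt q) + (pt q - pt r)).
  exact: plane_normD.
by rewrite addrA subrK.
Qed.

HB.instance Definition _ := isMetric.Build R (spaceX R)
  distXxx distX_positivity distX_sym distX_triangle.

End Metric.

Section Formulas.
Context {R : realType}.
Implicit Types (delta t : R) (p q : R * R).

Definition xcoord p q t : R := p.1 + t * (q.1 - p.1).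

Definition ycoord delta p q t : R :=
  if in_Xminus p && in_Xplus q then
    delta * Num.max (q.1 - p.1 - 4) 0 * Num.max 0 (1 - xcoord p q t ^+ 2)
  else if in_Xminus p && in_X0 q then
    Num.max 0 (q.2 / (q.1 + 1) * (xcoord p q t + 1))
  else if in_X0 p && in_Xplus q then
    Num.max 0 (p.2 / (p.1 - 1) * (xcoord p q t - 1))
  else if in_X0 p && in_X0 q then
    p.2 + t * (q.2 - p.2)
  else 0.

(* When p.1 = q.1 the two branches agree on points of X. *)
Definition sigma_pt delta p q t : R * R :=
  if p.1 <= q.1 then (xcoord p q t, ycoord delta p q t)
  else (xcoord q p (1 - t), ycoord delta q p (1 - t)).

Definition sigma_tilde_pt delta p q t : R * R :=
  if in_Xplus p && in_Xminus q then (xcoord p q t, 0)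
  else sigma_pt delta p q t.

Lemma in_X_xcoord p q t : in_X p -> in_X q -> 0 <= t <= 1 ->
  -3 <= xcoord p q t <= 3.
Proof. by rewrite /in_X /xcoord; nra. Qed.

Lemma in_X_ycoord delta p q t : 0 <= delta <= 64^-1 ->
  in_X p -> in_X q -> p.1 <= q.1 -> 0 <= t <= 1 ->
  in_X (xcoord p q t, ycoord delta p q t).
Proof.
move=> d01 Xp Xq pq t01; have xX := in_X_xcoord Xp Xq t01.
have xpq : p.1 <= xcoord p q t <= q.1 by rewrite /xcoord; nra.
rewrite /in_X /= xX /ycoord /=.
have m0 : 0 <= Num.max 0 (1 - xcoord p q t ^+ 2) by rewrite le_max lexx.
have m1 : 1 - xcoord p q t ^+ 2 <= Num.max 0 (1 - xcoord p q t ^+ 2).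
  by rewrite le_max lexx orbT.
case: ifPn => [/andP[pm qp]|_].
  set n := Num.max _ 0.
  have n02 : 0 <= n <= 2.
    rewrite /n le_max lexx orbT ge_max /=.
    by move: pm qp; rewrite /in_Xminus /in_Xplus; lra.
  have /andP[dn0 dn1] : 0 <= delta * n <= 32^-1 by nra.
  by rewrite mulr_ge0 ?ler_wpM2r.
case: ifPn => [/andP[pm q0]|_].
  rewrite le_max lexx /= ge_max mulr_ge0//=.
  move: q0; rewrite /in_X0 => /andP[/andP[q1 q2] /andP[q3 q4]].
  have [x1|x1] := leP (xcoord p q t) (-1).
    apply: le_trans (_ : 0 <= _); last by rewrite mulr_ge0//; lra.
    by rewrite mulr_ge0_le0 ?divr_ge0//; lra.
  apply: le_trans (_ : 32^-1 * (1 - xcoord p q t ^+ 2) <= _); last lra.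
  apply: le_trans (_ : 32^-1 * (1 - q.1) * (xcoord p q t + 1) <= _).
    rewrite ler_wpM2r//; first lra.
    by rewrite ler_pdivrMr; nra.
  by nra.
case: ifPn => [/andP[p0 qp]|_].
  rewrite le_max lexx /= ge_max mulr_ge0//=.
  move: p0; rewrite /in_X0 => /andP[/andP[p1 p2] /andP[p3 p4]].
  rewrite -mulrNN -mulrN -invrN !opprB.
  have [x1|x1] := leP 1 (xcoord p q t).
    apply: le_trans (_ : 0 <= _); last by rewrite mulr_ge0//; lra.
    by rewrite mulr_ge0_le0 ?divr_ge0//; lra.
  apply: le_trans (_ : 32^-1 * (1 - xcoord p q t ^+ 2) <= _); last lra.
  apply: le_trans (_ : 32^-1 * (1 + p.1) * (1 - xcoord p q t) <= _).
    rewrite ler_wpM2r//; first lra.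
    by rewrite ler_pdivrMr; nra.
  by nra.
case: ifPn => [/andP[p0 q0]|_]; last by rewrite lexx mulr_ge0//; lra.
move: p0 q0; rewrite /in_X0.
move=> /andP[p1 /andP[p2 p3]] /andP[q1 /andP[q2 q3]].
apply/andP; split; first by nra.
apply: le_trans (_ : 32^-1 * (1 - xcoord p q t ^+ 2) <= _); last lra.
apply: le_trans (_ : (1 - t) * (32^-1 * (1 - p.1 ^+ 2))
                       + t * (32^-1 * (1 - q.1 ^+ 2)) <= _); first by nra.
have : 0 <= t * (1 - t) * (p.1 - q.1) ^+ 2.
  by rewrite mulr_ge0 ?sqr_ge0// mulr_ge0//; lra.
by rewrite /xcoord; lra.
Qed.

Lemma in_X_sigma_pt delta p q t : 0 <= delta <= 64^-1 ->
  in_X p -> in_X q -> 0 <= t <= 1 -> in_X (sigma_pt delta p q t).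
Proof.
move=> d01 Xp Xq t01; rewrite /sigma_pt.
by case: leP => [pq|/ltW qp]; apply: in_X_ycoord => //; lra.
Qed.

Lemma in_X_sigma_tilde_pt delta p q t : 0 <= delta <= 64^-1 ->
  in_X p -> in_X q -> 0 <= t <= 1 -> in_X (sigma_tilde_pt delta p q t).
Proof.
move=> d01 Xp Xq t01; rewrite /sigma_tilde_pt.
case: ifPn => [_|_]; last exact: in_X_sigma_pt.
rewrite /in_X /= in_X_xcoord//= lexx mulr_ge0 ?le_max ?lexx//; lra.
Qed.

End Formulas.

Lemma i01_bounds (R : realType) (t : {i01 R}) : 0 <= t%:num <= 1.
Proof. by rewrite ge0 le1. Qed.

Definition sigma_tilde (R : realType) (delta : R)
    (delta_bounds : 0 <= delta <= 64^-1)
    (p q : spaceX R) (t : {i01 R}) : spaceX R :=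
  SpaceX (in_X_sigma_tilde_pt delta_bounds (ptP p) (ptP q) (i01_bounds t)).

(* Main.v *)
From mathcomp Require Import all_boot all_order all_algebra interval_inference.
From mathcomp Require Import ring lra.
From mathcomp Require Import all_classical all_reals topology normedtype convex.
Require Import Defs.

(** The norm equals |x| wherever |y| <= |x|, and sqrt(2)/2 times the Euclidean
    norm wherever |x| <= |y|.  Every curve of the bicombing has an affine first
    coordinate and a second coordinate of small slope, which gives the constant
    speed: the distance of two points of one curve is the distance of their
    abscissas, except on segments joining two points of the middle part, which
    are affine.

    Convexity.  Fix two curves, and let X, Y be the differences of their
    coordinates as functions of the time.  Since X is affine, |X| is convex and
    bounds the distance from below, so only the times with |Y| > |X| matter.
    Such a steep time has both curves inside the strip |x| < 1: where one of
    them is outside, its ordinate vanishes and the parabola y = (1 - x^2)/32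
    keeps the other one so low that 2|Y| <= |X|.  Hence the kinks of the curves
    at x = -1 and x = 1 are invisible.  Inside the strip Y is a polynomial of
    degree at most 2, and by the intermediate value theorem it is enough to
    compare the Euclidean norm of (X, Y) with its chords between two steep times
    in the strip ([steep_chords_convex]).

    A chord inequality for a curve with a constant second derivative (0, 2C)
    holds as soon as the bend C is dominated by the defect in the Cauchy-Schwarz
    inequality for the two end vectors ([norm2_bent_chord]).  With r the
    difference of the two horizontal speeds, a slope of Y small against r keeps
    this defect above a multiple of r^2 ([steep_angle]), so that
    |C||Y| <= r^2/20 is enough ([steep_chord]).

    Inside the strip a curve of horizontal speed v is either affine with v <= 4
    and with height and slope at most of order 4 - v, or it is the parabola
    delta (v - 4) (1 - x^2) with v >= 4.  Two parabolas differ, at a steep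
    time, by at most |r|/60, because delta <= 1/64; a parabola and an affine
    curve have r >= (v1 - 4) + (4 - v2), which dominates both heights and both
    slopes; two affine curves have C = 0.  In all cases the bound holds.  The
    first alternative includes the curves traversed from right to left, for
    which v <= 0: replacing parabolas by the horizontal axis in that direction
    therefore keeps convexity.

    The geodesics between (-3, 0) and (3, 0) in the two directions differ at the
    middle, and the one from left to right passes above the geodesic joining its
    points at x = -2 and x = 2, whose speed is 4. *)

Set Implicit Arguments.
Unset Strict Implicit.
Unset Printing Implicit Defensive.

Import Order.TTheory GRing.Theory Num.Theory.
Import numFieldNormedType.Exports.

Local Open Scope ring_scope.

(** * The shape of the norm *)

Section PlaneNormShape.
Context {R : realType}.
Implicit Types (x y : R) (u : R * R).

Lemma norm2_sqr u : norm2 u ^+ 2 = u.1 ^+ 2 + u.2 ^+ 2.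
Proof. by rewrite sqr_sqrtr// addr_ge0 ?sqr_ge0. Qed.

Lemma norm2_ge0 u : 0 <= norm2 u.
Proof. exact: sqrtr_ge0. Qed.

Lemma half_sqrt2_sqr : (Num.sqrt 2 / 2) ^+ 2 = 2^-1 :> R.
Proof. by rewrite exprMn sqr_sqrtr//; lra. Qed.

Lemma half_sqrt2_ge0 : 0 <= Num.sqrt 2 / 2 :> R.
Proof. by rewrite divr_ge0// sqrtr_ge0. Qed.

Lemma ler_norm_sqr (x y : R) : `|x| <= `|y| -> x ^+ 2 <= y ^+ 2.
Proof.
move=> xy; rewrite -(real_normK (num_real x)) -(real_normK (num_real y)).
by rewrite ler_pXn2r ?nnegrE.
Qed.

Lemma norm_le_plane_norm x y : `|x| <= plane_norm (x, y).
Proof. by rewrite /plane_norm /= le_max lexx. Qed.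

Lemma plane_norm_flat x y : `|y| <= `|x| -> plane_norm (x, y) = `|x|.
Proof.
move=> yx; apply/max_idPl => /=.
rewrite -ler_sqr ?nnegrE ?mulr_ge0 ?norm2_ge0 ?half_sqrt2_ge0//.
rewrite exprMn half_sqrt2_sqr norm2_sqr /= (real_normK (num_real _)).
by have := ler_norm_sqr yx; lra.
Qed.

Lemma plane_norm_steep x y : `|x| <= `|y| ->
  plane_norm (x, y) = Num.sqrt 2 / 2 * norm2 (x, y).
Proof.
move=> xy; apply/max_idPr => /=.
rewrite -ler_sqr ?nnegrE ?mulr_ge0 ?norm2_ge0 ?half_sqrt2_ge0//.
rewrite exprMn half_sqrt2_sqr norm2_sqr /= (real_normK (num_real _)).
by have := ler_norm_sqr xy; lra.
Qed.

Lemma plane_normZ (k : R) x y :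
  plane_norm (k * x, k * y) = `|k| * plane_norm (x, y).
Proof.
rewrite /plane_norm /norm2 /= normrM maxr_pMr ?normr_ge0// !exprMn -mulrDr.
by rewrite sqrtrM ?sqr_ge0// sqrtr_sqr mulrCA.
Qed.

End PlaneNormShape.

(** * Chords of bent curves in the steep region *)

Section Chord.
Context {R : realType}.
Implicit Types (l c k xa ya xb yb : R).

(** Squaring both sides: the difference of the squares is twice [l * (1 - l)]
    times the defect in the Cauchy-Schwarz inequality, minus the contribution of
    the vertical displacement [k]. *)
Lemma norm2_bent_chord l k xa ya xb yb : 0 <= l <= 1 ->
  k ^+ 2 - 2 * k * (l * ya + (1 - l) * yb) <=
    2 * (l * (1 - l)) *
      (norm2 (xa, ya) * norm2 (xb, yb) - (xa * xb + ya * yb)) ->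
  norm2 (l * xa + (1 - l) * xb, l * ya + (1 - l) * yb - k) <=
    l * norm2 (xa, ya) + (1 - l) * norm2 (xb, yb).
Proof.
move=> l01 kN.
have na := norm2_ge0 (xa, ya); have nb := norm2_ge0 (xb, yb).
have ea := norm2_sqr (xa, ya); have eb := norm2_sqr (xb, yb).
rewrite -ler_sqr ?nnegrE ?norm2_ge0//; last first.
  by rewrite addr_ge0 ?mulr_ge0//; lra.
rewrite norm2_sqr /= [leRHS]sqrrD ![in leRHS]exprMn ea eb /=.
by move: kN; lra.
Qed.

Lemma inner_le_norm2 xa ya xb yb :
  xa * xb + ya * yb <= norm2 (xa, ya) * norm2 (xb, yb).
Proof.
have na := norm2_ge0 (xa, ya); have nb := norm2_ge0 (xb, yb).
apply: le_trans (ler_norm _) _.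
rewrite -ler_sqr ?nnegrE ?mulr_ge0// (real_normK (num_real _)).
rewrite exprMn !norm2_sqr /=; have := sqr_ge0 (xa * yb - xb * ya); lra.
Qed.

Lemma norm2_chord l xa ya xb yb : 0 <= l <= 1 ->
  norm2 (l * xa + (1 - l) * xb, l * ya + (1 - l) * yb) <=
    l * norm2 (xa, ya) + (1 - l) * norm2 (xb, yb).
Proof.
move=> l01.
have := @norm2_bent_chord l 0 xa ya xb yb l01; rewrite subr0; apply.
rewrite expr0n /= mulr0 mul0r subr0.
apply: mulr_ge0; last by rewrite subr_ge0 inner_le_norm2.
by rewrite !mulr_ge0//; lra.
Qed.

(** The cross product of the end vectors is that of [(xa, ya)] with the vector
    from one end to the other.  The former is closer to the vertical than to the
    horizontal, and the latter is close to the horizontal. *)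
Lemma steep_cross xa ya xb yb : `|xa| <= `|ya| ->
  `|yb - ya| <= `|xb - xa| / 2 ->
  `|xb - xa| * `|ya| / 2 <= `|xa * yb - xb * ya|.
Proof.
move=> a_steep slope.
have -> : xa * yb - xb * ya = xa * (yb - ya) - (xb - xa) * ya by ring.
rewrite [leRHS]distrC; apply: le_trans (lerB_dist _ _); rewrite !normrM.
have := ler_pM (normr_ge0 _) (normr_ge0 _) a_steep slope; lra.
Qed.

(** Let N be the product of the norms and d the inner product.  Then N^2 - d^2
    is the square of the cross product, which [steep_cross] bounds from below
    from both ends; dividing by N + d <= 2 N leaves N - d. *)
Lemma steep_angle xa ya xb yb : `|xa| <= `|ya| -> `|xb| <= `|yb| ->
  `|yb - ya| <= `|xb - xa| / 2 ->
  (xb - xa) ^+ 2 / 16 <=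
    norm2 (xa, ya) * norm2 (xb, yb) - (xa * xb + ya * yb).
Proof.
move=> a_steep b_steep slope.
have slope' : `|ya - yb| <= `|xa - xb| / 2 by rewrite distrC (distrC xa).
have ca := steep_cross a_steep slope.
have cb := steep_cross b_steep slope'.
rewrite (distrC xa) (distrC (xb * ya)) in cb.
have := inner_le_norm2 xa ya xb yb.
set N := _ * norm2 _; set d := xa * xb + ya * yb => dN.
have N0 : 0 <= N by rewrite mulr_ge0 ?norm2_ge0.
have N2 : N ^+ 2 = d ^+ 2 + (xa * yb - xb * ya) ^+ 2.
  by rewrite /N /d exprMn !norm2_sqr /=; ring.
have Nle : N <= 2 * (`|ya| * `|yb|).
  rewrite -ler_sqr ?nnegrE ?mulr_ge0 ?norm2_ge0// /N !exprMn !norm2_sqr /=.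
  have := ler_norm_sqr a_steep; have := ler_norm_sqr b_steep.
  rewrite !(real_normK (num_real _)).
  have := sqr_ge0 xa; have := sqr_ge0 xb.
  have := sqr_ge0 ya; have := sqr_ge0 yb.
  nra.
have cross : (xb - xa) ^+ 2 * N / 8 <= (xa * yb - xb * ya) ^+ 2.
  have D0 := sqr_ge0 (xb - xa).
  apply: le_trans (_ : (xb - xa) ^+ 2 * (`|ya| * `|yb|) / 4 <= _).
    by nra.
  rewrite -(real_normK (num_real (xb - xa))).
  rewrite -(real_normK (num_real (xa * yb - xb * ya))).
  have := ler_pM _ _ ca cb; rewrite !divr_ge0 ?mulr_ge0// => /(_ isT isT).
  lra.
(* If N vanishes, one end vector is zero, and the slope condition then forces
   the two abscissas to agree. *)
have [N_gt0|] := ltP 0 N.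
  have : (xb - xa) ^+ 2 / 8 * N <= (N - d) * (2 * N).
    by nra.
  rewrite mulrCA -mulrA; nra.
move=> Nle0; have {Nle0} NE : N = 0.
  by apply/eqP; rewrite eq_le Nle0.
suff -> : xb = xa.
  by rewrite subrr expr0n /= mul0r subr_ge0.
move: N2; rewrite NE expr0n /= => N2.
have d0 : d = 0.
  apply/eqP; rewrite -sqrf_eq0; apply/eqP.
  by have := sqr_ge0 d; have := sqr_ge0 (xa * yb - xb * ya); lra.
have c0 : xa * yb - xb * ya = 0.
  apply/eqP; rewrite -sqrf_eq0; apply/eqP.
  by have := sqr_ge0 d; have := sqr_ge0 (xa * yb - xb * ya); lra.
rewrite c0 normr0 in ca cb.
apply/eqP; rewrite -subr_eq0; apply: contraT => Dn0.
have Dp : 0 < `|xb - xa| by rewrite normr_gt0.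
have ya0 : `|ya| = 0.
  by apply/eqP; rewrite eq_le normr_ge0 andbT -(pmulr_rle0 _ Dp); lra.
have yb0 : `|yb| = 0.
  by apply/eqP; rewrite eq_le normr_ge0 andbT -(pmulr_rle0 _ Dp); lra.
move: a_steep b_steep; rewrite ya0 yb0 !normr_le0 => /eqP xa0 /eqP xb0.
by rewrite xa0 xb0 subrr eqxx in Dn0.
Qed.

(** On a parabola of second derivative [2 * C], two points at times [s] and [t]
    are joined by a chord whose vertical distance to the curve is
    [l * (1 - l) * c] with [c = C * (s - t) ^+ 2]. *)
Lemma steep_chord l c xa ya xb yb : 0 <= l <= 1 ->
  `|xa| <= `|ya| -> `|xb| <= `|yb| -> `|yb - ya| <= `|xb - xa| / 2 ->
  `|c| * `|ya| <= (xb - xa) ^+ 2 / 20 -> `|c| * `|yb| <= (xb - xa) ^+ 2 / 20 ->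
  (xb = xa -> c = 0) ->
  norm2 (l * xa + (1 - l) * xb, l * ya + (1 - l) * yb - l * (1 - l) * c) <=
    l * norm2 (xa, ya) + (1 - l) * norm2 (xb, yb).
Proof.
move=> l01 a_steep b_steep slope ca cb c0.
apply: norm2_bent_chord => //.
have angle := steep_angle a_steep b_steep slope.
have L0 : 0 <= l * (1 - l) by nra.
have L1 : l * (1 - l) <= 4^-1 by have := sqr_ge0 (l - 2^-1); lra.
set w := l * ya + _; set L := l * (1 - l) in L0 L1 *.
have cw : - (c * w) <= (xb - xa) ^+ 2 / 20.
  apply: le_trans (ler_norm _) _; rewrite normrN normrM.
  apply: le_trans (_ : `|c| * (l * `|ya| + (1 - l) * `|yb|) <= _).
    rewrite ler_wpM2l//; apply: le_trans (ler_normD _ _) _.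
    have [l0 l1] : 0 <= l /\ 0 <= 1 - l by split; lra.
    by rewrite !normrM (ger0_norm l0) (ger0_norm l1).
  by nra.
(* In the steep region the horizontal distance of the ends is bounded by the sum
   of their heights, so the bounds on [c] times the heights bound [c] itself. *)
have cD : c ^+ 2 <= (xb - xa) ^+ 2 / 100.
  have [/eqP|Dn0] := eqVneq (xb - xa) 0.
    rewrite subr_eq0 => /eqP xab; rewrite c0// xab subrr expr0n /=.
    by rewrite mul0r.
  have Dp : 0 < (xb - xa) ^+ 2 by rewrite exprn_even_gt0.
  have D1 : `|xb - xa| <= `|ya| + `|yb|.
    by apply: le_trans (ler_normB _ _) _; lra.
  have : `|c| * `|xb - xa| <= (xb - xa) ^+ 2 / 10.
    apply: le_trans (_ : `|c| * (`|ya| + `|yb|) <= _).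
      by rewrite ler_wpM2l.
    by lra.
  move=> h; have : (`|c| * `|xb - xa|) ^+ 2 <= ((xb - xa) ^+ 2 / 10) ^+ 2.
    rewrite ler_sqr // nnegrE; first by rewrite mulr_ge0.
    by rewrite divr_ge0 // ltW.
  rewrite [leLHS]exprMn !(real_normK (num_real _)) => h2.
  rewrite -(ler_pM2r Dp); apply: le_trans h2 _.
  by rewrite expr2; lra.
have h : L * c ^+ 2 - 2 * (c * w) <= (xb - xa) ^+ 2 / 8.
  have : L * c ^+ 2 <= 4^-1 * c ^+ 2 by rewrite ler_wpM2r ?sqr_ge0.
  by have := sqr_ge0 (xb - xa); lra.
have : L * (L * c ^+ 2 - 2 * (c * w)) <= L * ((xb - xa) ^+ 2 / 8).
  by rewrite ler_wpM2l.
have : L * ((xb - xa) ^+ 2 / 16) <=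
    L * (norm2 (xa, ya) * norm2 (xb, yb) - (xa * xb + ya * yb)).
  by rewrite ler_wpM2l.
by lra.
Qed.

End Chord.

(** * Convexity from chords in the steep region *)

Section SteepChords.
Context {R : realType}.

Definition affine (X : R -> R) :=
  forall l s t, X (l * s + (1 - l) * t) = l * X s + (1 - l) * X t.

Lemma continuous_line (a v : R) : continuous (fun t : R => a + t * v).
Proof.
move=> t; apply: (@continuousD _ _ _ (fun=> a) (fun u : R => u * v)).
  exact: cst_continuous.
exact: mulrr_continuous.
Qed.

(** Going from a steep time [z] back towards [a], one stays in the region where
    [Y] is the polynomial [P] ([g <= 0]) until the curve stops being steep, or
    up to [a] if it never does.  At the place reached, the norm is below [L]:
    either it is [a], or the norm is just |X| there. *)
Lemma retreat_to_flat (X Y P g L : R -> R) (a z : R) :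
  continuous X -> continuous P -> continuous g ->
  (forall u, 0 <= u <= 1 -> let c := a + u * (z - a) in
    [/\ g c <= 0 -> Y c = P c, 0 <= g c -> 2 * `|Y c| <= `|X c|
      & `|X c| <= L c]) ->
  plane_norm (X a, Y a) <= L a ->
  g z < 0 -> `|X z| < `|Y z| ->
  exists2 u, 0 <= u <= 1 & let c := a + u * (z - a) in
    [/\ g c <= 0, `|X c| <= `|P c| & plane_norm (X c, Y c) <= L c].
Proof.
move=> cX cP cg H fa gz z_steep.
have a0 : a + 0 * (z - a) = a by rewrite mul0r addr0.
have z1 : a + 1 * (z - a) = z by rewrite mul1r addrC subrK.
have [Ya Yga _] := H 0 ltac:(lra); rewrite a0 in Ya Yga.
have [Yz _ _] := H 1 ltac:(lra); rewrite z1 in Yz.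
have [a_flat|a_steep] := leP `|Y a| `|X a|; last first.
  have ga : g a <= 0.
    rewrite leNgt; apply/negP => /ltW /Yga; have := normr_ge0 (Y a).
    by move: a_steep; lra.
  exists 0; first by lra.
  by rewrite a0 /= -(Ya ga) (ltW a_steep).
(* [phi] is negative exactly at the steep times with [g < 0]; its zero is the
   place sought. *)
pose phi (t : R) : R := Num.max (`|X t| - `|P t|) (g t).
have phi_cont : continuous (fun u : R => phi (a + u * (z - a))).
  move=> u; apply: (@continuous_comp _ _ _ (fun u : R => a + u * (z - a)) phi).
      exact: continuous_line.
  apply: (@continuous_max _ _ (fun t => `|X t| - `|P t|) g); last exact: cg.
  apply: (@continuousB _ _ _ (fun t => `|X t|) (fun t => `|P t|)).
    by apply: (@continuous_comp _ _ _ X Num.norm);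
      [exact: cX|exact: norm_continuous].
  by apply: (@continuous_comp _ _ _ P Num.norm);
    [exact: cP|exact: norm_continuous].
have phi0 : 0 <= phi a.
  rewrite /phi le_max; have [ga|ga] := leP (g a) 0.
    by rewrite subr_ge0 -(Ya ga) a_flat.
  by rewrite (ltW ga) orbT.
have phi1 : phi z <= 0.
  by rewrite /phi ge_max (ltW gz) andbT subr_le0 -(Yz (ltW gz)) ltW.
have phi_bounds : Num.min (phi (a + 0 * (z - a))) (phi (a + 1 * (z - a))) <= 0
    <= Num.max (phi (a + 0 * (z - a))) (phi (a + 1 * (z - a))).
  by rewrite a0 z1 ge_min le_max phi0 phi1 orbT.
have [u] := @IVT R (fun u => phi (a + u * (z - a))) 0 1 0 ler01
  (continuous_subspaceT phi_cont) phi_bounds.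
rewrite in_itv /= => u01.
have := H u u01; set c := a + u * (z - a) => -[Yc Ygc XL] phic.
have [gc0 Xc] : g c <= 0 /\ `|X c| <= `|P c|.
  have : phi c <= 0 by rewrite phic.
  by rewrite /phi ge_max subr_le0 => /andP[].
(* If the zero comes from [g], then 2|Y| <= |X|; otherwise |X| = |P|. *)
have Yc_flat : `|Y c| <= `|X c|.
  have [gc|gc] := ltP (g c) 0.
    have : 0 <= phi c by rewrite phic.
    by rewrite /phi le_max subr_ge0 (leNgt 0) gc orbF (Yc gc0).
  by have := Ygc gc; have := normr_ge0 (Y c); lra.
exists u => //; rewrite -/c; split => //.
by rewrite plane_norm_flat.
Qed.

(** A chord of the norm between the times 0 and 1 lies above |X|.  At a steep
    time [z], one shrinks the interval from both sides to steep times where the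
    norm is below that chord, and uses the chord inequality between them.  The
    function [g] describes the region [g <= 0] in which [Y] is given by [P]. *)
Lemma steep_chords_convex01 (X Y P g : R -> R) (z : R) :
  affine X -> continuous X -> continuous P -> continuous g ->
  (forall t, 0 <= t <= 1 -> g t <= 0 -> Y t = P t) ->
  (forall t, 0 <= t <= 1 -> 0 <= g t -> 2 * `|Y t| <= `|X t|) ->
  (forall l s t, 0 <= l <= 1 -> 0 <= s <= 1 -> 0 <= t <= 1 ->
    g s <= 0 -> g t <= 0 -> `|X s| <= `|P s| -> `|X t| <= `|P t| ->
    norm2 (l * X s + (1 - l) * X t, P (l * s + (1 - l) * t)) <=
      l * norm2 (X s, P s) + (1 - l) * norm2 (X t, P t)) ->
  0 <= z <= 1 ->
  plane_norm (X z, Y z) <=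
    (1 - z) * plane_norm (X 0, Y 0) + z * plane_norm (X 1, Y 1).
Proof.
move=> aX cX cP cg YP Yg steep z01.
pose L t : R := (1 - t) * plane_norm (X 0, Y 0) + t * plane_norm (X 1, Y 1).
have XL t : 0 <= t <= 1 -> `|X t| <= L t.
  move=> t01; have -> : X t = (1 - t) * X 0 + t * X 1.
    by have := aX (1 - t) 0 1; rewrite mulr0 add0r mulr1 !subKr.
  apply: le_trans (ler_normD _ _) _; rewrite !normrM.
  have [t0 t1] : 0 <= t /\ 0 <= 1 - t by split; lra.
  rewrite (ger0_norm t0) (ger0_norm t1).
  by rewrite lerD// ler_wpM2l// norm_le_plane_norm.
rewrite -/(L z).
have [Yz_flat|z_steep] := leP `|Y z| `|X z|.
  by rewrite plane_norm_flat// XL.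
have gz : g z < 0.
  rewrite ltNge; apply/negP => /(Yg _ z01); have := normr_ge0 (Y z).
  by move: z_steep; lra.
have H a : 0 <= a <= 1 -> forall u, 0 <= u <= 1 -> let c := a + u * (z - a) in
    [/\ g c <= 0 -> Y c = P c, 0 <= g c -> 2 * `|Y c| <= `|X c|
      & `|X c| <= L c].
  move=> a01 u u01 c; have c01 : 0 <= c <= 1 by rewrite /c; nra.
  by split=> [/(YP _ c01)|/(Yg _ c01)|]; rewrite ?XL.
have [||u u01] := retreat_to_flat cX cP cg (H 0 _) _ gz z_steep.
- by rewrite lexx ler01.
- by rewrite /L subr0 mul1r mul0r addr0.
set c0 := 0 + _ => -[gc0 steep0 L0].
have [||w w01] := retreat_to_flat cX cP cg (H 1 _) _ gz z_steep.
- by rewrite lexx ler01.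
- by rewrite /L subrr mul1r mul0r add0r.
set c1 := 1 + _ => -[gc1 steep1 L1].
have c0z : 0 <= c0 <= z by rewrite /c0; nra.
have zc1 : z <= c1 <= 1 by rewrite /c1; nra.
have c0_01 : 0 <= c0 <= 1 by lra.
have c1_01 : 0 <= c1 <= 1 by lra.
rewrite (YP _ c0_01 gc0) in L0; rewrite (YP _ c1_01 gc1) in L1.
have Yz := YP _ z01 (ltW gz).
have [c01|c01] := eqVneq c0 c1.
  have -> : z = c0 by lra.
  by rewrite (YP _ c0_01 gc0).
have d_gt0 : 0 < c1 - c0.
  by rewrite subr_gt0 lt_neqAle c01; lra.
pose l := (c1 - z) / (c1 - c0).
have l01 : 0 <= l <= 1.
  by rewrite /l divr_ge0 ?ler_pdivrMr ?mul1r; lra.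
have zE : z = l * c0 + (1 - l) * c1 by rewrite /l; field; lra.
have := steep l c0 c1 l01 c0_01 c1_01 gc0 gc1 steep0 steep1.
rewrite -aX -zE -Yz => h.
rewrite plane_norm_steep; last exact: ltW.
rewrite (plane_norm_steep steep0) in L0.
rewrite (plane_norm_steep steep1) in L1.
apply: le_trans (ler_wpM2l half_sqrt2_ge0 h) _.
have -> : L z = l * L c0 + (1 - l) * L c1 by rewrite {1}zE /L; ring.
have : l * (Num.sqrt 2 / 2 * norm2 (X c0, P c0)) <= l * L c0.
  by rewrite ler_wpM2l//; lra.
have : (1 - l) * (Num.sqrt 2 / 2 * norm2 (X c1, P c1)) <= (1 - l) * L c1.
  by rewrite ler_wpM2l//; lra.
by lra.
Qed.

(** [steep_chords_convex01] after the reparametrization which sends 0 and 1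
    to [b] and [a]. *)
Lemma steep_chords_convex (X Y P g : R -> R) :
  affine X -> continuous X -> continuous P -> continuous g ->
  (forall t, 0 <= t <= 1 -> g t <= 0 -> Y t = P t) ->
  (forall t, 0 <= t <= 1 -> 0 <= g t -> 2 * `|Y t| <= `|X t|) ->
  (forall l s t, 0 <= l <= 1 -> 0 <= s <= 1 -> 0 <= t <= 1 ->
    g s <= 0 -> g t <= 0 -> `|X s| <= `|P s| -> `|X t| <= `|P t| ->
    norm2 (l * X s + (1 - l) * X t, P (l * s + (1 - l) * t)) <=
      l * norm2 (X s, P s) + (1 - l) * norm2 (X t, P t)) ->
  forall l a b, 0 <= l <= 1 -> 0 <= a <= 1 -> 0 <= b <= 1 ->
  plane_norm (X (l * a + (1 - l) * b), Y (l * a + (1 - l) * b)) <=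
    l * plane_norm (X a, Y a) + (1 - l) * plane_norm (X b, Y b).
Proof.
move=> aX cX cP cg YP Yg steep l a b l01 a01 b01.
pose line (t : R) : R := b + t * (a - b).
have line01 t : 0 <= t <= 1 -> 0 <= line t <= 1 by rewrite /line; nra.
have line_affine : affine line by move=> k s t; rewrite /line; ring.
have line_cont (f : R -> R) : continuous f -> continuous (f \o line).
  move=> cf t; apply: continuous_comp; [exact: continuous_line|exact: cf].
have line0 : line 0 = b by rewrite /line mul0r addr0.
have line1 : line 1 = a by rewrite /line mul1r addrC subrK.
have lineE : l * a + (1 - l) * b = line l by rewrite /line; ring.
rewrite lineE addrC -{2}line0 -{2}line1 -{1}line0 -{1}line1.
apply: (@steep_chords_convex01
  (X \o line) (Y \o line) (P \o line) (g \o line) l) => //.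
- by move=> k s t /=; rewrite line_affine aX.
- exact: line_cont.
- exact: line_cont.
- exact: line_cont.
- by move=> t t01 /=; apply: YP; apply: line01.
- by move=> t t01 /=; apply: Yg; apply: line01.
- move=> k s t k01 s01 t01 /=; rewrite line_affine.
  by apply: steep => //; apply: line01.
Qed.

End SteepChords.

(** * Distance between two curves of the family *)

Section TwoCurves.
Context {R : realType} (delta : R) (delta_bounds : 0 <= delta <= 64^-1).
Implicit Types (a v l s t r C : R) (y : R -> R).

Definition under_roof a v y := forall t, 0 <= t <= 1 ->
  0 <= y t <= 32^-1 * Num.max 0 (1 - (a + t * v) ^+ 2).

(** The alternatives for a curve with abscissa [a + t * v] and ordinate [y],
    on the part of it in the strip |x| <= 1.  The ordinate outside of the strip
    is controlled by [under_roof]. *)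
Definition humped a v y := 4 <= v <= 6 /\
  forall t, 0 <= t <= 1 -> `|a + t * v| <= 1 ->
    y t = delta * (v - 4) * (1 - (a + t * v) ^+ 2).

(** The height and the slope are measured against [4 - v], because this is what
    the difference of the speeds to a humped curve, of speed at least 4, leaves
    available. *)
Definition straight a v y := v <= 4 /\
  exists b e, `|e| <= 3 / 16 * (4 - v) /\
    forall t, 0 <= t <= 1 -> `|a + t * v| <= 1 ->
      y t = b + t * e /\ 0 <= y t <= (4 - v) / 16.

(** The roof vanishes at x = 1 and x = -1 and has slope at most 1/16. *)
Lemma roof_le_dist (x1 x2 : R) : 1 <= `|x1| ->
  32^-1 * Num.max 0 (1 - x2 ^+ 2) <= `|x1 - x2| / 16.
Proof.
move=> x1_ge1; have d := lerB_dist x1 x2; have d0 := normr_ge0 (x1 - x2).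
have [x2_ge1|x2_lt1] := leP 0 (1 - x2 ^+ 2).
  rewrite -(real_normK (num_real x2)) in x2_ge1 *.
  have := normr_ge0 x2; nra.
by rewrite mulr0; lra.
Qed.

Lemma roof_ge1 (x : R) : 1 <= `|x| -> Num.max 0 (1 - x ^+ 2) = 0.
Proof.
move=> x1; apply/max_idPl; rewrite -(real_normK (num_real x)).
by nra.
Qed.

Lemma roof_flat a1 v1 a2 v2 y1 y2 t : 0 <= t <= 1 ->
  under_roof a1 v1 y1 -> under_roof a2 v2 y2 -> 1 <= `|a1 + t * v1| ->
  2 * `|y1 t - y2 t| <= `|(a1 + t * v1) - (a2 + t * v2)|.
Proof.
move=> t01 /(_ t t01) r1 /(_ t t01) r2 x1.
have d := roof_le_dist (a2 + t * v2) x1.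
have d0 := normr_ge0 (a1 + t * v1 - (a2 + t * v2)).
move: r1; rewrite roof_ge1// mulr0 => r1.
have -> : y1 t = 0 by lra.
by rewrite sub0r normrN (ger0_norm (_ : 0 <= y2 t)); lra.
Qed.

Definition gap_norm a1 v1 y1 a2 v2 y2 t : R :=
  plane_norm ((a1 + t * v1) - (a2 + t * v2), y1 t - y2 t).

(** The hypotheses of [steep_chord] for the difference of two curves, with
    [C] the coefficient of [t ^+ 2] in the difference of the ordinates. *)
Definition bending a1 v1 a2 v2 (y1 y2 : R -> R) C :=
  (v1 = v2 -> C = 0) /\
  forall s t, 0 <= s <= 1 -> 0 <= t <= 1 ->
    let x1 t := a1 + t * v1 in let x2 t := a2 + t * v2 in
    `|x1 s| <= 1 -> `|x1 t| <= 1 -> `|x2 s| <= 1 -> `|x2 t| <= 1 ->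
    `|x1 s - x2 s| <= `|y1 s - y2 s| -> `|x1 t - x2 t| <= `|y1 t - y2 t| ->
    [/\ `|(y1 t - y2 t) - (y1 s - y2 s)| <= `|v1 - v2| * `|t - s| / 2,
        `|C| * `|y1 s - y2 s| <= (v1 - v2) ^+ 2 / 20
      & `|C| * `|y1 t - y2 t| <= (v1 - v2) ^+ 2 / 20].

Lemma quadratic_gap_convex a1 v1 a2 v2 y1 y2 b e C :
  under_roof a1 v1 y1 -> under_roof a2 v2 y2 ->
  (forall t, 0 <= t <= 1 -> `|a1 + t * v1| <= 1 -> `|a2 + t * v2| <= 1 ->
     y1 t - y2 t = b + t * e + C * t ^+ 2) ->
  C = 0 \/ bending a1 v1 a2 v2 y1 y2 C ->
  forall l s t, 0 <= l <= 1 -> 0 <= s <= 1 -> 0 <= t <= 1 ->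
  gap_norm a1 v1 y1 a2 v2 y2 (l * s + (1 - l) * t) <=
    l * gap_norm a1 v1 y1 a2 v2 y2 s + (1 - l) * gap_norm a1 v1 y1 a2 v2 y2 t.
Proof.
move=> roof1 roof2 quad bend.
pose X t : R := (a1 + t * v1) - (a2 + t * v2).
pose P t : R := b + t * e + C * t ^+ 2.
pose g t : R := Num.max (`|a1 + t * v1| - 1) (`|a2 + t * v2| - 1).
have g_le0 u : g u <= 0 -> `|a1 + u * v1| <= 1 /\ `|a2 + u * v2| <= 1.
  by rewrite /g ge_max !subr_le0 => /andP[].
have norm_line_cont a v : continuous (fun t : R => `|a + t * v| - 1).
  move=> u; apply: (@continuousB _ _ _ (fun t => `|a + t * v|) (fun=> 1)).
    apply: (@continuous_comp _ _ _ (fun t => a + t * v) Num.norm).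
      exact: continuous_line.
    exact: norm_continuous.
  exact: cst_continuous.
apply: (@steep_chords_convex _ X (fun t => y1 t - y2 t) P g).
- by move=> k u w; rewrite /X; ring.
- move=> u.
  by apply: (@continuousB _ _ _ (fun t => a1 + t * v1) (fun t => a2 + t * v2));
    exact: continuous_line.
- move=> u.
  apply: (@continuousD _ _ _ (fun t => b + t * e) (fun t => C * t ^+ 2)).
    exact: continuous_line.
  apply: (@continuousM _ _ (fun=> C) (fun t => t ^+ 2)).
    exact: cst_continuous.
  by apply: (@continuousM _ _ id id); exact: cvg_id.
- move=> u; apply: (@continuous_max _ _ (fun t => `|a1 + t * v1| - 1)
    (fun t => `|a2 + t * v2| - 1)); exact: norm_line_cont.
- by move=> u u01 /g_le0[]; exact: quad.
- move=> u u01; rewrite /g le_max !subr_ge0 => /orP[x1|x2].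
    exact: roof_flat.
  rewrite distrC [leRHS]distrC; exact: roof_flat.
move=> k u w k01 u01 w01 /g_le0[x1u x2u] /g_le0[x1w x2w] steep_u steep_w.
have PE : P (k * u + (1 - k) * w) =
    k * P u + (1 - k) * P w - k * (1 - k) * (C * (u - w) ^+ 2).
  by rewrite /P; ring.
rewrite PE; case: bend => [C0|[C0 bend]].
  by rewrite C0 mul0r mulr0 subr0; exact: norm2_chord.
have Pu : P u = y1 u - y2 u by rewrite (quad u).
have Pw : P w = y1 w - y2 w by rewrite (quad w).
have [||slope bu bw] := bend u w u01 w01 x1u x1w x2u x2w.
- by rewrite -Pu.
- by rewrite -Pw.
rewrite -Pu -Pw in slope bu bw.
have Xuw : X w - X u = (v1 - v2) * (w - u) by rewrite /X; ring.
have uw0 : 0 <= (u - w) ^+ 2 := sqr_ge0 _.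
apply: steep_chord => //.
- by rewrite Xuw normrM.
- rewrite Xuw normrM (ger0_norm uw0); nra.
- rewrite Xuw normrM (ger0_norm uw0); nra.
- move/eqP; rewrite -subr_eq0 Xuw mulf_eq0 !subr_eq0 => /orP[/eqP/C0->|/eqP->].
    by rewrite mul0r.
  by rewrite subrr expr0n /= mulr0.
Qed.

(** The difference of the heights is (v1 - v2) (1 - x1^2) plus a multiple of
    x1 - x2, both times delta.  At a steep time the second term is a
    small fraction of the difference itself. *)
Lemma hump_gap (v1 v2 x1 x2 : R) (D := delta * (v1 - 4) * (1 - x1 ^+ 2) -
    delta * (v2 - 4) * (1 - x2 ^+ 2)) : 4 <= v2 <= 6 ->
  `|x1| <= 1 -> `|x2| <= 1 -> `|x1 - x2| <= `|D| -> `|D| <= `|v1 - v2| / 60.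
Proof.
move=> v2_bounds x1_le1 x2_le1 steep.
have /andP[delta0 delta1] := delta_bounds.
have DE : D = delta * ((v1 - v2) * (1 - x1 ^+ 2)
    + (v2 - 4) * (x1 + x2) * (x2 - x1)) by rewrite /D; ring.
have h1 : `|1 - x1 ^+ 2| <= 1.
  move: x1_le1; rewrite !ler_norml => h; apply/andP; split; nra.
have h2 : `|(v2 - 4) * (x1 + x2)| <= 4.
  rewrite normrM; apply: le_trans (_ : 2 * 2 <= _); last lra.
  apply: ler_pM => //; first by rewrite ger0_norm; lra.
  by apply: le_trans (ler_normD _ _) _; lra.
have : `|D| <= delta * (`|v1 - v2| + 4 * `|x1 - x2|).
  rewrite DE normrM (ger0_norm delta0); apply: ler_wpM2l => //.
  apply: le_trans (ler_normD _ _) _.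
  rewrite normrM (normrM (_ * (x1 + x2))) (distrC x2).
  by apply: lerD; [rewrite ler_piMr|rewrite ler_wpM2r].
have := normr_ge0 (v1 - v2); have := normr_ge0 (x1 - x2).
by clear -delta0 delta1 steep; nra.
Qed.

(** The mean slopes differ by a multiple of [v1 - v2], due to the coefficients
    of the two parabolas, and by a multiple of the gaps between the abscissas,
    which are also small against [v1 - v2].  Here [d] is the time elapsed from
    [x1], [x2] to [w1], [w2]. *)
Lemma hump_slope (v1 v2 x1 x2 w1 w2 d : R)
    (D := fun x1 x2 => delta * (v1 - 4) * (1 - x1 ^+ 2) -
      delta * (v2 - 4) * (1 - x2 ^+ 2)) :
  4 <= v1 <= 6 -> 4 <= v2 <= 6 -> `|x1| <= 1 -> `|w1| <= 1 ->
  `|x1 - x2| <= `|v1 - v2| / 60 -> `|w1 - w2| <= `|v1 - v2| / 60 ->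
  w1 - x1 = d * v1 -> w2 - x2 = d * v2 ->
  `|D w1 w2 - D x1 x2| <= `|v1 - v2| * `|d| / 2.
Proof.
move=> v1_bounds v2_bounds x1_le1 w1_le1 x12 w12 w1E w2E.
have -> : D w1 w2 - D x1 x2 = delta * (- d) *
    ((v1 - v2) * ((v1 + v2 - 4) * (x1 + w1))
      + (v2 - 4) * v2 * ((x1 - x2) + (w1 - w2))).
  have -> : w1 = x1 + d * v1 by rewrite -w1E addrC subrK.
  have -> : w2 = x2 + d * v2 by rewrite -w2E addrC subrK.
  by rewrite /D; ring.
have d0 := normr_ge0 d; have r0 := normr_ge0 (v1 - v2).
have /andP[delta0 delta1] := delta_bounds.
rewrite normrM normrM normrN (ger0_norm delta0).
have h1 : `|(v1 - v2) * ((v1 + v2 - 4) * (x1 + w1))| <= `|v1 - v2| * 16.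
  rewrite normrM ler_wpM2l// normrM; apply: le_trans (_ : 8 * 2 <= _); last lra.
  apply: ler_pM => //; first by rewrite ger0_norm; lra.
  by apply: le_trans (ler_normD _ _) _; lra.
have h2 : `|(v2 - 4) * v2 * ((x1 - x2) + (w1 - w2))| <= 12 * (`|v1 - v2| / 30).
  rewrite normrM; apply: ler_pM => //.
    by rewrite ger0_norm; nra.
  by apply: le_trans (ler_normD _ _) _; lra.
apply: le_trans (_ : 64^-1 * `|d| *
    (`|v1 - v2| * 16 + 12 * (`|v1 - v2| / 30)) <= _).
  apply: ler_pM => //; first by rewrite mulr_ge0//; lra.
    by rewrite ler_wpM2r//; lra.
  by apply: le_trans (ler_normD _ _) _; lra.
by have := mulr_ge0 r0 d0; lra.
Qed.

(** A hump traversed at speed [v] has second derivative [- 2 * hump_bend v]. *)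
Definition hump_bend v : R := delta * (v - 4) * v ^+ 2.

Lemma hump_bend_le (v1 v2 : R) : 4 <= v1 <= 6 -> 4 <= v2 <= 6 ->
  `|hump_bend v2 - hump_bend v1| <= `|v1 - v2|.
Proof.
move=> v1_bounds v2_bounds.
have -> : hump_bend v2 - hump_bend v1 = (v2 - v1) * (delta *
    (v1 * (v1 - 4) + v2 * (v2 - 4) + v1 * v2)).
  by rewrite /hump_bend; ring.
have /andP[delta0 delta1] := delta_bounds.
have h : 0 <= v1 * (v1 - 4) + v2 * (v2 - 4) + v1 * v2 <= 60.
  by apply/andP; split; nra.
rewrite normrM (distrC v2) ler_piMr// ger0_norm; nra.
Qed.

Lemma hump_hump_bending a1 v1 a2 v2 y1 y2 :
  humped a1 v1 y1 -> humped a2 v2 y2 ->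
  bending a1 v1 a2 v2 y1 y2 (hump_bend v2 - hump_bend v1).
Proof.
move=> [v1_bounds y1E] [v2_bounds y2E].
split=> [->|s t s01 t01 x1 x2 x1s x1t x2s x2t]; first by rewrite subrr.
rewrite !(y1E s) ?(y1E t) ?(y2E s) ?(y2E t)//.
rewrite -/(x1 s) -/(x1 t) -/(x2 s) -/(x2 t).
move=> steep_s steep_t.
have gs := hump_gap v2_bounds x1s x2s steep_s.
have gt := hump_gap v2_bounds x1t x2t steep_t.
have C1 := hump_bend_le v1_bounds v2_bounds.
have square (D : R) : `|D| <= `|v1 - v2| / 60 ->
    `|hump_bend v2 - hump_bend v1| * `|D| <= (v1 - v2) ^+ 2 / 20.
  move=> Dle; rewrite -(real_normK (num_real (v1 - v2))).
  have := ler_pM (normr_ge0 _) (normr_ge0 _) C1 Dle.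
  by have := sqr_ge0 `|v1 - v2|; lra.
split; [|exact: square|exact: square].
apply: hump_slope => //; [exact: le_trans gs|exact: le_trans gt| |].
- by rewrite /x1; ring.
- by rewrite /x2; ring.
Qed.

(** Everything is bounded in terms of the two nonnegative numbers [v1 - 4] and
    [4 - v2], whose sum is the difference of the speeds. *)
Lemma hump_straight_bending a1 v1 a2 v2 y1 y2 :
  humped a1 v1 y1 -> straight a2 v2 y2 ->
  bending a1 v1 a2 v2 y1 y2 (- hump_bend v1).
Proof.
move=> [v1_bounds y1E] [v2_le4 [b [e [e_le y2E]]]].
split=> [v12|s t s01 t01 x1 x2 x1s x1t x2s x2t _ _].
  by rewrite /hump_bend (_ : v1 - 4 = 0) ?mulr0 ?mul0r ?oppr0//; lra.
have /andP[delta0 delta1] := delta_bounds.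
have r0 : 0 <= v1 - v2 by lra.
have bend0 : `|- hump_bend v1| <= (v1 - v2) * (36 / 64).
  have v1sq : 0 <= v1 ^+ 2 <= 36 by apply/andP; split; nra.
  have dv : 0 <= delta * (v1 - 4) <= 64^-1 * (v1 - v2).
    by apply/andP; split; nra.
  by rewrite normrN /hump_bend ger0_norm; nra.
have gap u : 0 <= u <= 1 -> `|x1 u| <= 1 -> `|x2 u| <= 1 ->
    `|- hump_bend v1| * `|y1 u - y2 u| <= (v1 - v2) ^+ 2 / 20.
  move=> u01 x1u x2u.
  have [_ y2_bounds] := y2E u u01 x2u.
  have y1_bounds : 0 <= y1 u <= (v1 - 4) / 16.
    rewrite y1E// -/(x1 u).
    have h1 : 0 <= 1 - x1 u ^+ 2 <= 1.
      by move: x1u; rewrite ler_norml => h; apply/andP; split; nra.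
    have dv : 0 <= delta * (v1 - 4) <= 64^-1 * (v1 - 4).
      by apply/andP; split; nra.
    by apply/andP; split; nra.
  have : `|y1 u - y2 u| <= (v1 - v2) / 16 by rewrite ler_norml; lra.
  move=> h; have := ler_pM (normr_ge0 _) (normr_ge0 _) bend0 h.
  by have := sqr_ge0 (v1 - v2); lra.
split; [|exact: gap|exact: gap].
have [y2s _] := y2E s s01 x2s; have [y2t _] := y2E t t01 x2t.
rewrite y2s y2t !y1E// -/(x1 s) -/(x1 t).
have -> : delta * (v1 - 4) * (1 - x1 t ^+ 2) - (b + t * e) -
    (delta * (v1 - 4) * (1 - x1 s ^+ 2) - (b + s * e)) =
    (t - s) * - (delta * (v1 - 4) * v1 * (x1 s + x1 t) + e).
  by rewrite /x1; ring.
rewrite normrM normrN (ger0_norm r0) [leRHS]mulrAC mulrC ler_wpM2r//.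
apply: le_trans (ler_normD _ _) _.
have dv : 0 <= delta * (v1 - 4) * v1 <= 6 / 64 * (v1 - 4).
  have dv : 0 <= delta * (v1 - 4) <= 64^-1 * (v1 - 4) by apply/andP; split; nra.
  by apply/andP; split; nra.
have xst : `|x1 s + x1 t| <= 2 by apply: le_trans (ler_normD _ _) _; lra.
have /andP[dv0 dv1] := dv.
have := ler_pM (normr_ge0 _) (normr_ge0 _)
  (_ : `|delta * (v1 - 4) * v1| <= 6 / 64 * (v1 - 4)) xst.
rewrite -normrM (ger0_norm dv0) => /(_ dv1).
by lra.
Qed.

Lemma humped_or_straight_convex a1 v1 a2 v2 y1 y2 :
  under_roof a1 v1 y1 -> under_roof a2 v2 y2 ->
  humped a1 v1 y1 \/ straight a1 v1 y1 ->
  humped a2 v2 y2 \/ straight a2 v2 y2 ->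
  forall l s t, 0 <= l <= 1 -> 0 <= s <= 1 -> 0 <= t <= 1 ->
  gap_norm a1 v1 y1 a2 v2 y2 (l * s + (1 - l) * t) <=
    l * gap_norm a1 v1 y1 a2 v2 y2 s + (1 - l) * gap_norm a1 v1 y1 a2 v2 y2 t.
Proof.
move: a1 v1 a2 v2 y1 y2.
have mixed a1 v1 a2 v2 y1 y2 : under_roof a1 v1 y1 -> under_roof a2 v2 y2 ->
    humped a1 v1 y1 -> straight a2 v2 y2 ->
    forall l s t, 0 <= l <= 1 -> 0 <= s <= 1 -> 0 <= t <= 1 ->
    gap_norm a1 v1 y1 a2 v2 y2 (l * s + (1 - l) * t) <=
      l * gap_norm a1 v1 y1 a2 v2 y2 s + (1 - l) * gap_norm a1 v1 y1 a2 v2 y2 t.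
  move=> roof1 roof2 h1 s2 l s t l01 s01 t01.
  have bend := hump_straight_bending h1 s2.
  case: h1 s2 => [_ y1E] [_ [b [e [_ y2E]]]].
  apply: (quadratic_gap_convex (b := delta * (v1 - 4) * (1 - a1 ^+ 2) - b)
    (e := - 2 * delta * (v1 - 4) * a1 * v1 - e)
    roof1 roof2 _ (or_intror bend)) => // u u01 x1 x2.
  by have [-> _] := y2E u u01 x2; rewrite y1E// /hump_bend; ring.
move=> a1 v1 a2 v2 y1 y2 roof1 roof2 [h1|s1] [h2|s2] l s t l01 s01 t01.
- have bend := hump_hump_bending h1 h2.
  case: h1 h2 => [_ y1E] [_ y2E].
  apply: (quadratic_gap_convex
    (b := delta * (v1 - 4) * (1 - a1 ^+ 2) - delta * (v2 - 4) * (1 - a2 ^+ 2))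
    (e := 2 * delta * ((v2 - 4) * a2 * v2 - (v1 - 4) * a1 * v1))
    roof1 roof2 _ (or_intror bend)) => // u u01 x1 x2.
  by rewrite y1E// y2E// /hump_bend; ring.
- exact: mixed.
- have swap u : gap_norm a1 v1 y1 a2 v2 y2 u = gap_norm a2 v2 y2 a1 v1 y1 u.
    rewrite /gap_norm -plane_normN; congr plane_norm.
    by congr pair => /=; rewrite opprB.
  by rewrite !swap; exact: mixed.
- case: s1 s2 => [_ [b1 [e1 [_ y1E]]]] [_ [b2 [e2 [_ y2E]]]].
  apply: (quadratic_gap_convex (C := 0) (b := b1 - b2) (e := e1 - e2)
    roof1 roof2 _ (or_introl _)) => // u u01 x1 x2.
  by have [-> _] := y1E u u01 x1; have [-> _] := y2E u u01 x2; ring.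
Qed.

End TwoCurves.

(** * The geodesics as straight or humped curves *)

Section Curves.
Context {R : realType} (delta : R) (delta_bounds : 0 <= delta <= 64^-1).
Implicit Types (p q : R * R) (a v s t : R) (y : R -> R).

Lemma in_X_cases p : in_X p -> [|| in_Xminus p, in_X0 p | in_Xplus p].
Proof.
rewrite /in_X /in_Xminus /in_X0 /in_Xplus.
move=> /andP[/andP[p_ge p_le] /andP[y_ge y_le]].
rewrite p_ge p_le y_ge /= andbT.
have [p1|p1] := leP p.1 (-1); first by
  rewrite roof_ge1 ?mulr0 in y_le;
    [rewrite eq_le y_le y_ge|rewrite ler0_norm; lra].
have [p2|p2] := leP 1 p.1; first by
  rewrite roof_ge1 ?mulr0 in y_le;
    [rewrite eq_le y_le y_ge orbT|rewrite ger0_norm; lra].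
rewrite /= orbF.
by move: y_le; rewrite (max_idPr _) //; nra.
Qed.

Lemma roof_lip (a b : R) :
  `|Num.max 0 (1 - a ^+ 2) - Num.max 0 (1 - b ^+ 2)| <= 2 * `|a - b|.
Proof.
move: a b.
suff half (a b : R) :
    Num.max 0 (1 - a ^+ 2) - Num.max 0 (1 - b ^+ 2) <= 2 * `|a - b|.
  by move=> a b; rewrite ler_norml half andbT lerNl opprB distrC half.
have d := lerB_dist a b; have d' := lerB_dist b a; rewrite (distrC b) in d'.
have a0 := normr_ge0 a; have b0 := normr_ge0 b.
have dn := normr_ge0 (a - b).
rewrite -(real_normK (num_real a)) -(real_normK (num_real b)).
move: `|a - b| `|a| `|b| d d' a0 b0 dn => n x z d d' x0 z0 n0.
have [hx|hx] := leP 0 (1 - x ^+ 2); have [hz|hz] := leP 0 (1 - z ^+ 2).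
- have z1 : z <= 1 by nra.
  have x1 : x <= 1 by nra.
  have : 0 <= (n - (z - x)) * (z + x) by rewrite mulr_ge0//; lra.
  have : 0 <= n * (2 - (z + x)) by rewrite mulr_ge0//; lra.
  lra.
- have x1 : x <= 1 by nra.
  have z1 : 1 <= z by nra.
  have : 0 <= (1 - x) * (1 - x) by rewrite mulr_ge0//; lra.
  lra.
- lra.
- lra.
Qed.

(** The truncations in the definition of the curves do not increase slopes. *)
Lemma max0_lip (a b : R) : `|Num.max 0 a - Num.max 0 b| <= `|a - b|.
Proof.
suff half (c d : R) : Num.max 0 c - Num.max 0 d <= `|c - d|.
  by rewrite ler_norml half andbT lerNl opprB distrC half.
have := ler_norm (c - d); have := normr_ge0 (c - d).
by case: (leP 0 c); case: (leP 0 d); lra.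
Qed.

(** Since [v >= 0], reversing the time only enlarges [4 - v]. *)
Lemma straight_rev a v y : 0 <= v -> straight a v y ->
  straight (a + v) (- v) (fun t => y (1 - t)).
Proof.
move=> v0 [v4 [b [e [eb yE]]]]; split; first lra.
exists (b + e), (- e); split; first by rewrite normrN; lra.
move=> t t01 x1; have [||yE1 yE2] := yE (1 - t); first lra.
  by rewrite (_ : _ + _ = a + v + t * - v)//; ring.
by split; [rewrite yE1; ring|lra].
Qed.

(** A point under the roof at distance [w] from one foot and [u] from the other
    is seen from the first one with a slope of at most [u / 32]. *)
Lemma chord_slope_bounds (h w u : R) : 0 < w -> 0 <= h ->
  h <= 32^-1 * (w * u) -> 0 <= h / w <= u / 32.
Proof.
move=> w0 h0 hw; rewrite divr_ge0 ?(ltW w0)//= ler_pdivrMr//; lra.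
Qed.

(** For a geodesic from the left arm to a middle point q, the slope seen from
    (-1, 0) is at most (1 - x_q)/32, while v <= x_q + 3, that is,
    1 - x_q <= 4 - v; symmetrically on the right.  A geodesic within the middle
    part has v < 2, and all the others stay on the axis with v <= 2. *)
Lemma ycoord_straight p q : in_X p -> in_X q -> p.1 <= q.1 ->
  ~~ (in_Xminus p && in_Xplus q) ->
  straight p.1 (q.1 - p.1) (ycoord delta p q).
Proof.
move=> Xp Xq pq npq.
have [b [e [v4 [eb yE]]]] : exists b e, q.1 - p.1 <= 4 /\
    `|e| <= 3 / 16 * (4 - (q.1 - p.1)) /\ forall t, 0 <= t <= 1 ->
      `|xcoord p q t| <= 1 -> ycoord delta p q t = b + t * e /\
        0 <= ycoord delta p q t <= (4 - (q.1 - p.1)) / 16; last first.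
  by split=> //; exists b, e.
rewrite /ycoord (negbTE npq).
have [pm_q0|npq1] := boolP (in_Xminus p && in_X0 q).
  have /andP[pm q0] := pm_q0.
  have [s0 s1] : 0 <= q.2 / (q.1 + 1) /\ q.2 / (q.1 + 1) <= (1 - q.1) / 32.
    move: q0 => /andP[/andP[q1 q2] /andP[q3 q4]].
    by apply/andP; apply: chord_slope_bounds => //; nra.
  move: (q.2 / _) s0 s1 => s s0 s1.
  move: pm q0; rewrite /in_Xminus /in_X0 => /andP[pm _] /andP[q1 _].
  exists (s * (p.1 + 1)), (s * (q.1 - p.1)).
  split; first lra.
  split; first by rewrite ger0_norm; nra.
  move=> t t01; rewrite ler_norml => x1.
  have -> : Num.max 0 (s * (xcoord p q t + 1)) = s * (xcoord p q t + 1).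
    by apply/max_idPr; rewrite mulr_ge0//; lra.
  by split; [rewrite /xcoord; ring|nra].
have [p0_qp|npq2] := boolP (in_X0 p && in_Xplus q).
  have /andP[p0 qp] := p0_qp.
  have [s0 s1] : 0 <= p.2 / (1 - p.1) /\ p.2 / (1 - p.1) <= (1 + p.1) / 32.
    move: p0 => /andP[/andP[q1 q2] /andP[q3 q4]].
    by apply/andP; apply: chord_slope_bounds => //; nra.
  rewrite -(opprB 1 p.1) invrN mulrN.
  move: (p.2 / _) s0 s1 => s s0 s1.
  move: p0 qp; rewrite /in_Xplus /in_X0 => /andP[p1 _] /andP[qp _].
  exists (s * (1 - p.1)), (- s * (q.1 - p.1)).
  split; first lra.
  split; first by rewrite normrM normrN !ger0_norm; nra.
  move=> t t01; rewrite ler_norml => x1.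
  have -> : Num.max 0 (- s * (xcoord p q t - 1)) = s * (1 - xcoord p q t).
    by rewrite mulNr -mulrN opprB; apply/max_idPr; rewrite mulr_ge0//; lra.
  by split; [rewrite /xcoord; ring|nra].
have [p0_q0|npq3] := boolP (in_X0 p && in_X0 q).
  have /andP[p0 q0] := p0_q0.
  exists p.2, (q.2 - p.2).
  move: p0 q0; rewrite /in_X0 => /andP[p1 p2] /andP[q1 q2].
  have p2' : 0 <= p.2 <= 32^-1 by have := sqr_ge0 p.1; lra.
  have q2' : 0 <= q.2 <= 32^-1 by have := sqr_ge0 q.1; lra.
  split; first lra.
  split; first by rewrite ler_norml; lra.
  move=> t t01 _; split=> //.
  by nra.
exists 0, 0; have v4 : q.1 - p.1 <= 4.
  move: (in_X_cases Xp) (in_X_cases Xq) npq npq1 npq2 npq3.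
  rewrite /in_Xminus /in_X0 /in_Xplus.
  move=> /or3P[] /andP[hp ->] /or3P[] /andP[hq ->]; rewrite ?hp ?hq //=; lra.
split=> //; split; first by rewrite normr0; lra.
by move=> t t01 _; rewrite mulr0 addr0; split=> //; lra.
Qed.

Lemma ycoord_humped p q : in_Xminus p -> in_Xplus q ->
  humped delta p.1 (q.1 - p.1) (ycoord delta p q) \/
  straight p.1 (q.1 - p.1) (ycoord delta p q).
Proof.
move=> pm qp; rewrite /ycoord pm qp /=.
move: pm qp; rewrite /in_Xminus /in_Xplus => /andP[pm _] /andP[qp _].
have [v4|v4] := leP 4 (q.1 - p.1).
  left; split; first lra.
  move=> t t01 x1; rewrite (max_idPl _); last lra.
  rewrite (max_idPr _)//.
  by move: x1; rewrite ler_norml /xcoord; nra.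
right; split; first exact: ltW.
exists 0, 0; split; first by rewrite normr0; lra.
move=> t t01 _; rewrite (max_idPr _); last lra.
by rewrite !(mulr0, mul0r) addr0; split=> //; lra.
Qed.

Lemma sigma_tilde_fst p q t : (sigma_tilde_pt delta p q t).1 = xcoord p q t.
Proof.
rewrite /sigma_tilde_pt /sigma_pt; case: ifP => // _.
by case: ifP => //= _; rewrite /xcoord; ring.
Qed.

Lemma sigma_tilde_humped_or_straight p q : in_X p -> in_X q ->
  let y t := (sigma_tilde_pt delta p q t).2 in
  humped delta p.1 (q.1 - p.1) y \/ straight p.1 (q.1 - p.1) y.
Proof.
move=> Xp Xq; rewrite /sigma_tilde_pt /sigma_pt.
have [pp_qm|npq] := boolP (in_Xplus p && in_Xminus q).
  have /andP[/andP[pp _] /andP[qm _]] := pp_qm.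
  right; split; first lra.
  exists 0, 0; split; first by rewrite normr0; lra.
  by move=> t _ _; rewrite mulr0 addr0 /=; split=> //; lra.
have [pq|pq] := leP p.1 q.1.
  have [/andP[pm qp]|npq'] := boolP (in_Xminus p && in_Xplus q).
    exact: ycoord_humped.
  by right; apply: ycoord_straight.
right; rewrite -(opprB p.1) (_ : p.1 = q.1 + (p.1 - q.1)); last by ring.
rewrite [X in straight _ X _](_ : _ = - (p.1 - q.1)); last by ring.
apply: straight_rev; first lra.
by apply: ycoord_straight => //; [exact: ltW|rewrite andbC].
Qed.

Lemma sigma_tilde_under_roof p q : in_X p -> in_X q ->
  under_roof p.1 (q.1 - p.1) (fun t => (sigma_tilde_pt delta p q t).2).
Proof.
move=> Xp Xq t t01; have := in_X_sigma_tilde_pt delta_bounds Xp Xq t01.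
by rewrite /in_X sigma_tilde_fst => /andP[].
Qed.

Lemma ycoord_end p q : in_X p -> in_X q -> p.1 <= q.1 ->
  ycoord delta p q 0 = p.2 /\ ycoord delta p q 1 = q.2.
Proof.
move=> Xp Xq pq.
have x0 : xcoord p q 0 = p.1 by rewrite /xcoord mul0r addr0.
have x1 : xcoord p q 1 = q.1 by rewrite /xcoord mul1r addrC subrK.
rewrite /ycoord x0 x1.
case: ifPn => [/andP[/andP[pm /eqP->] /andP[qp /eqP->]]|npq].
  rewrite !roof_ge1 ?mulr0//; [rewrite ger0_norm|rewrite ler0_norm]; lra.
case: ifPn => [/andP[/andP[pm /eqP->] /andP[q1 q2]]|npq1].
  have w0 : 0 < q.1 + 1 by lra.
  split; last by rewrite divfK ?gt_eqF//; apply/max_idPr; lra.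
  by apply/max_idPl; rewrite mulr_ge0_le0 ?divr_ge0 ?(ltW w0)//; lra.
case: ifPn => [/andP[/andP[p1 p2] /andP[qp /eqP->]]|npq2].
  have w0 : p.1 - 1 < 0 by lra.
  split; first by rewrite divfK ?lt_eqF//; apply/max_idPr; lra.
  apply/max_idPl; rewrite mulr_le0_ge0//; last lra.
  by rewrite mulr_ge0_le0 ?invr_le0 ?(ltW w0)//; lra.
case: ifPn => [/andP[p0 q0]|npq3]; first by split; ring.
move: (in_X_cases Xp) (in_X_cases Xq) npq npq1 npq2 npq3.
rewrite /in_Xminus /in_X0 /in_Xplus.
move=> /or3P[] /andP[hp hp'] /or3P[] /andP[hq hq'];
  rewrite ?hp ?hq ?hp' ?hq' //=; lra.
Qed.

(** Two sufficient conditions for constant speed: the curve is an affine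
    segment, or it is nowhere steep. *)
Definition even_speed p q y :=
  (forall t, y t = p.2 + t * (q.2 - p.2)) \/
  (forall s t, 0 <= s <= 1 -> 0 <= t <= 1 ->
    `|y s - y t| <= `|xcoord p q s - xcoord p q t|).

Lemma ycoord_even_speed p q : in_X p -> in_X q -> p.1 <= q.1 ->
  even_speed p q (ycoord delta p q).
Proof.
move=> Xp Xq pq; have /andP[delta0 delta1] := delta_bounds.
rewrite /even_speed /ycoord.
have [pm_qp|npq] := boolP (in_Xminus p && in_Xplus q).
  have /andP[/andP[pm _] /andP[qp _]] := pm_qp.
  right=> s t s01 t01; rewrite -mulrBr normrM.
  have m02 : 0 <= Num.max (q.1 - p.1 - 4) 0 <= 2.
    by rewrite le_max lexx orbT ge_max; lra.
  have dm : 0 <= delta * Num.max (q.1 - p.1 - 4) 0 <= 2^-1 by nra.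
  rewrite ger0_norm; last by case/andP: dm.
  have := roof_lip (xcoord p q s) (xcoord p q t).
  have := normr_ge0 (Num.max 0 (1 - xcoord p q s ^+ 2)
    - Num.max 0 (1 - xcoord p q t ^+ 2)).
  by move: `|_ - _| => n; move: (delta * _) dm => k dm n0 h; nra.
have slope (k c s t : R) : `|k| <= 1 ->
    `|Num.max 0 (k * (xcoord p q s + c)) - Num.max 0 (k * (xcoord p q t + c))|
      <= `|xcoord p q s - xcoord p q t|.
  move=> k1; apply: le_trans (max0_lip _ _) _; rewrite -mulrBr normrM.
  rewrite (_ : _ + c - _ = xcoord p q s - xcoord p q t); last by ring.
  by rewrite ler_piMl.
have [pm_q0|npq1] := boolP (in_Xminus p && in_X0 q).
  have /andP[pm /andP[/andP[q1 q2] /andP[q3 q4]]] := pm_q0.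
  right=> s t _ _; apply: slope.
  have /andP[k0 k1] : 0 <= q.2 / (q.1 + 1) <= (1 - q.1) / 32.
    by apply: chord_slope_bounds => //; nra.
  by rewrite ger0_norm//; lra.
have [p0_qp|npq2] := boolP (in_X0 p && in_Xplus q).
  have /andP[/andP[/andP[p1 p2] /andP[p3 p4]] qp] := p0_qp.
  right=> s t _ _; apply: slope.
  have /andP[k0 k1] : 0 <= p.2 / (1 - p.1) <= (1 + p.1) / 32.
    by apply: chord_slope_bounds => //; nra.
  by rewrite -(opprB 1 p.1) invrN mulrN normrN ger0_norm//; lra.
have [_|npq3] := boolP (in_X0 p && in_X0 q); first by left.
by right=> s t _ _; rewrite subrr normr0.
Qed.

Lemma sigma_tilde_even_speed p q : in_X p -> in_X q ->
  even_speed p q (fun t => (sigma_tilde_pt delta p q t).2).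
Proof.
move=> Xp Xq; rewrite /sigma_tilde_pt /sigma_pt.
have [pp_qm|npq] := boolP (in_Xplus p && in_Xminus q).
  by right=> s t _ _; rewrite /= subrr normr0.
have [pq|/ltW qp] := leP p.1 q.1; first exact: ycoord_even_speed.
case: (ycoord_even_speed Xq Xp qp) => [yE|ylip].
  by left=> t; rewrite /= yE; ring.
right=> s t s01 t01 /=; apply: le_trans (ylip (1 - s) (1 - t) _ _) _; try lra.
by rewrite /xcoord le_eqVlt; apply/orP; left; apply/eqP; congr Num.norm; ring.
Qed.

Lemma sigma_tilde_end p q : in_X p -> in_X q ->
  sigma_tilde_pt delta p q 0 = p /\ sigma_tilde_pt delta p q 1 = q.
Proof.
move=> Xp Xq.
suff [y0 y1] : (sigma_tilde_pt delta p q 0).2 = p.2 /\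
    (sigma_tilde_pt delta p q 1).2 = q.2.
  rewrite [LHS]surjective_pairing [X in _ /\ X = _]surjective_pairing.
  rewrite y0 y1 !sigma_tilde_fst /xcoord mul0r addr0 mul1r addrC subrK.
  by case: p q {Xp Xq y0 y1} => [? ?] [].
rewrite /sigma_tilde_pt /sigma_pt.
case: ifPn => [/andP[/andP[_ /eqP->] /andP[_ /eqP->]]//|npq].
have [pq|/ltW qp] := leP p.1 q.1; first exact: ycoord_end.
by have [] := ycoord_end Xq Xp qp; rewrite subr0 subrr.
Qed.

End Curves.

(** * The bicombing *)

Section Bicombing.
Context {R : realType} (delta : R) (delta_bounds : 0 <= delta <= 64^-1).
Local Notation sigma := (sigma_tilde delta_bounds).

Lemma sigma_tilde_bicombing : bicombing sigma.
Proof.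
move=> p q; have [p0 q1] := sigma_tilde_end delta (ptP p) (ptP q).
split; [exact: val_inj|exact: val_inj|move=> s t].
rewrite -[mdist (sigma p q t) _]/(plane_norm (sigma_tilde_pt delta p q t%:num
  - sigma_tilde_pt delta p q s%:num)) -[mdist p q]/(plane_norm (pt p - pt q)).
have surj (u : R * R) : u = (u.1, u.2) by case: u.
rewrite (surj (_ - _)) [X in plane_norm X](surj) /= !sigma_tilde_fst.
rewrite [in RHS](surj (pt p - pt q)) /=.
have xE : xcoord p q t%:num - xcoord p q s%:num =
    (s%:num - t%:num) * ((pt p).1 - (pt q).1) by rewrite /xcoord; ring.
rewrite distrC.
case: (sigma_tilde_even_speed delta_bounds (ptP p) (ptP q)) => [yE|ylip].
  rewrite !yE xE (_ : _ + _ - _ = (s%:num - t%:num) * ((pt p).2 - (pt q).2)).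
    exact: plane_normZ.
  by ring.
rewrite plane_norm_flat; last by apply: ylip; exact: i01_bounds.
have := ylip 0 1; rewrite p0 q1 /xcoord mul0r mul1r addr0 addrCA subrr addr0.
move=> h; rewrite plane_norm_flat; last by apply: h; rewrite ?lexx ?ler01.
by rewrite xE normrM.
Qed.

Lemma sigma_tilde_convex p q p' q' :
  @convex_function R R^o `[0, 1]%classic
    (extend01 (fun t => mdist (sigma p q t) (sigma p' q' t))).
Proof.
move=> l s t; rewrite !inE /= !in_itv /= => s01 t01.
rewrite !convRE.
pose y t := (sigma_tilde_pt delta p q t).2.
pose y' t := (sigma_tilde_pt delta p' q' t).2.
have distE u : 0 <= u <= 1 ->
    extend01 (fun t => mdist (sigma p q t) (sigma p' q' t)) u =
    gap_norm (pt p).1 ((pt q).1 - (pt p).1) y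
      (pt p').1 ((pt q').1 - (pt p').1) y' u.
  move=> u01; rewrite /extend01.
  have vE : (insubd 0%:i01 u : {i01 R})%:num = u.
    have /andP[u0 u1] := u01.
    have -> : insubd (0%:i01 : {i01 R}) u = Itv01 u0 u1.
      exact: (valKd _ (Itv01 u0 u1)).
    by [].
  rewrite -[mdist _ _]/(plane_norm (sigma_tilde_pt delta p q _
    - sigma_tilde_pt delta p' q' _)) vE /gap_norm; congr plane_norm.
  have surj (v : R * R) : v = (v.1, v.2) by case: v.
  by rewrite [LHS]surj /= !sigma_tilde_fst.
have l01 := i01_bounds l.
have st01 : 0 <= l%:num * s + (1 - l%:num) * t <= 1 by nra.
rewrite !distE//.
by apply: humped_or_straight_convex => //;
  [exact: delta_bounds
  |exact: sigma_tilde_under_roof (ptP p) (ptP q)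
  |exact: sigma_tilde_under_roof (ptP p') (ptP q')
  |exact: sigma_tilde_humped_or_straight (ptP p) (ptP q)
  |exact: sigma_tilde_humped_or_straight (ptP p') (ptP q')].
Qed.

Lemma in_X_axis (x : R) : -3 <= x <= 3 -> in_X (x, 0).
Proof. by move=> xb; rewrite /in_X /= xb lexx mulr_ge0// le_max lexx. Qed.

Definition axis_point (x : R) (xb : -3 <= x <= 3) : spaceX R :=
  SpaceX (in_X_axis xb).

Lemma sigma_tilde_minus_plus (a b : R) (t : R) : -3 <= a <= -1 -> 1 <= b <= 3 ->
  sigma_tilde_pt delta (a, 0) (b, 0) t = (xcoord (a, 0) (b, 0) t,
    delta * Num.max (b - a - 4) 0 *
      Num.max 0 (1 - xcoord (a, 0) (b, 0) t ^+ 2)).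
Proof.
move=> ab bb; rewrite /sigma_tilde_pt /sigma_pt /ycoord /in_Xplus /in_Xminus /=.
have -> : (1 <= a) = false by apply/negbTE; rewrite -ltNge; lra.
have a_le_b : a <= b by lra.
by rewrite ab bb eqxx /= a_le_b.
Qed.

Lemma sigma_tilde_plus_minus (a b : R) (t : R) : 1 <= a <= 3 -> -3 <= b <= -1 ->
  sigma_tilde_pt delta (a, 0) (b, 0) t = (xcoord (a, 0) (b, 0) t, 0).
Proof.
by move=> ab bb; rewrite /sigma_tilde_pt /in_Xplus /in_Xminus /= ab bb eqxx.
Qed.

Lemma three_bounds : -3 <= (3 : R) <= 3. Proof. lra. Qed.
Lemma minus_three_bounds : -3 <= (-3 : R) <= 3. Proof. lra. Qed.

Lemma sigma_tilde_not_reversible : 0 < delta -> ~ reversible sigma.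
Proof.
move=> delta_gt0 rev.
have h0 : 0 <= (2^-1 : R) by lra.
have h1 : (2^-1 : R) <= 1 by lra.
have := congr1 (fun u : spaceX R => (pt u).2)
  (rev (axis_point minus_three_bounds) (axis_point three_bounds) (Itv01 h0 h1)).
rewrite /= sigma_tilde_minus_plus; try lra.
rewrite sigma_tilde_plus_minus /xcoord /=; try lra.
rewrite (max_idPl _); last lra.
rewrite (max_idPr _); last by nra.
move=> H; have : delta * 2 = 0 by (rewrite -[RHS]H; field). lra.
Qed.

(** On the geodesic from (-3, 0) to (3, 0), the points (-2, 0) and (2, 0) are
    reached at the times 1/6 and 5/6.  Their distance is 4, so the geodesic
    between them follows the axis, but the longer one meets x = 0 only at the
    height 2 delta. *)
Lemma sigma_tilde_not_consistent : 0 < delta -> ~ consistent sigma.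
Proof.
move=> delta_gt0 cons.
pose p := axis_point minus_three_bounds; pose q := axis_point three_bounds.
have s0 : 0 <= (6^-1 : R) by lra.
have s1 : (6^-1 : R) <= 1 by lra.
have t0 : 0 <= (5 / 6 : R) by lra.
have t1 : (5 / 6 : R) <= 1 by lra.
have lo : -3 <= (-3 : R) <= -1 by lra.
have hi : 1 <= (3 : R) <= 3 by lra.
have ptE u : pt (sigma p q u) = (xcoord (-3, 0) (3, 0) u%:num,
    delta * 2 * Num.max 0 (1 - xcoord (-3, 0) (3, 0) u%:num ^+ 2)).
  rewrite [LHS](sigma_tilde_minus_plus _ lo hi).
  by rewrite (max_idPl _); [congr (_, _ * _ * _); ring|lra].
have p'E : pt (sigma p q (Itv01 s0 s1)) = (-2, 0).
  rewrite ptE /xcoord /=; congr pair; first by field.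
  by rewrite (max_idPl _) ?mulr0//; lra.
have q'E : pt (sigma p q (Itv01 t0 t1)) = (2, 0).
  rewrite ptE /xcoord /=; congr pair; first by field.
  by rewrite (max_idPl _) ?mulr0//; lra.
have lo' : -3 <= (-2 : R) <= -1 by lra.
have hi' : 1 <= (2 : R) <= 3 by lra.
have st : (Itv01 s0 s1)%:num <= (Itv01 t0 t1)%:num by rewrite /=; lra.
have h0 : 0 <= (2^-1 : R) by lra.
have h1 : (2^-1 : R) <= 1 by lra.
have [|u _ uE] := cons p q _ _ _ _ st erefl erefl
  (sigma (sigma p q (Itv01 s0 s1)) (sigma p q (Itv01 t0 t1)) (Itv01 h0 h1)).
  by exists (Itv01 h0 h1).
have := congr1 (@pt R) uE.
rewrite ptE -[RHS]/(sigma_tilde_pt delta (pt (sigma p q (Itv01 s0 s1)))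
  (pt (sigma p q (Itv01 t0 t1))) 2^-1).
rewrite p'E q'E (sigma_tilde_minus_plus _ lo' hi').
rewrite [Num.max (2 - -2 - 4) 0](max_idPr _); last lra.
rewrite mulr0 mul0r => -[xE /eqP].
have -> : xcoord (-3, 0) (3, 0) u%:num = 0 :> R by rewrite xE /xcoord /=; field.
rewrite expr0n subr0 (max_idPr ler01) mulr1 mulf_eq0 gt_eqF//=.
by rewrite pnatr_eq0.
Qed.

End Bicombing.

Theorem proposition2p4 (R : realType) (delta : R)
    (delta_bounds : 0 <= delta <= 64^-1) (delta_gt0 : 0 < delta) :
  convex_bicombing (sigma_tilde delta_bounds) /\
  ~ reversible (sigma_tilde delta_bounds) /\
  ~ consistent (sigma_tilde delta_bounds).
Proof.
split; first by split; [exact: sigma_tilde_bicombing|exact: sigma_tilde_convex].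
by split; [exact: sigma_tilde_not_reversible|exact: sigma_tilde_not_consistent].
Qed.
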